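(* Let $c_1, c_2$ be rational numbers with $0 \le c_1, c_2 \le 1$. There exists an infinite family of $(c_1,c_2)$-mixed graphs $G_m$ such that each $G_m$, of order $n$, satisfies $$\delta(G_m) \ge \frac{1}{2-c_1-c_2}\, n + \frac{2}{2-c_1-c_2}\cdot\frac{\ln n}{2\ln \frac{27}{4}},$$ and the oriented diameter of $G_m$ is at least three (i.e., no orientation of $G_m$ has diameter at most $2$).
   Context: A mixed graph $G$ has a finite vertex set $V(G)$ and an edge set $E(G)$ consisting of undirected edges $xy$ and directed edges (arcs) $\overrightarrow{xy}$; there are no loops and no parallel edges. For $x \in V(G)$: $N^+_G(x)=\{y : \overrightarrow{xy}\in E(G)\}$, $N^-_G(x)=\{y:\overrightarrow{yx}\in E(G)\}$, $N^0_G(x)=\{y: xy\in E(G)\}$, $N_G(x)=N^+_G(x)\cup N^-_G(x)\cup N^0_G(x)$; the degree is $d_G(x)=|N_G(x)|$, the out-degree $d^+_G(x)=|N^+_G(x)|$, the in-degree $d^-_G(x)=|N^-_G(x)|$, and $\delta(G)$ is the minimum degree. For rational numbers $0\le c_1,c_2\le 1$, $G$ is a $(c_1,c_2)$-mixed graph if $d^+_G(u)\le c_1 d_G(u)$ and $d^-_G(u)\le c_2 d_G(u)$ for every $u\in V(G)$. An orientation of $G$ is a directed graph obtained by assigning a direction to every undirected edge of $G$ (directed edges keep their direction). The oriented diameter of $G$ is the minimum, over all strongly connected orientations $D$ of $G$, of the diameter of $D$ (the maximum over ordered pairs of distinct vertices $(u,v)$ of the length of a shortest directed path from $u$ to $v$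 in $D$).
   Formalization: Assumes c1+c2<1 and that c1=0 exactly when c2=0; otherwise the claim fails: for c1+c2≥1 the bound forces δ≥n or is undefined, and if exactly one is 0 there are no arcs and large graphs of this minimum degree have an orientation of diameter 2. *)

(* Defs.v *)
From HB Require Import structures.
From mathcomp Require Import all_boot all_order all_algebra.
From mathcomp Require Import boolp classical_sets reals constructive_ereal ereal exp.

Set Implicit Arguments.
Unset Strict Implicit.
Unset Printing Implicit Defensive.

Import Order.TTheory GRing.Theory Num.Theory.
Local Open Scope ring_scope.

(* There is at most one edge, of either kind, between two vertices; in
   particular [darc x y] and [darc y x] exclude each other. The vertex set is
   nonempty, so that the minimum degree makes sense. *)
Record mixed_graph := MixedGraph {
  vertex :> finType;
  uedge : rel vertex;
  darc : rel vertex;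
  vertex_gt0 : (0 < #|vertex|)%N;
  uedge_sym : symmetric uedge;
  uedge_irr : irreflexive uedge;
  darc_irr : irreflexive darc;
  darc_asym : forall x y, darc x y -> ~~ darc y x;
  darc_uedge : forall x y, darc x y -> ~~ uedge x y }.

Section MixedGraph.
Variable G : mixed_graph.

Definition out_nbrs (x : G) : {set G} := [set y | darc x y].
Definition in_nbrs (x : G) : {set G} := [set y | darc y x].
Definition und_nbrs (x : G) : {set G} := [set y | uedge x y].
Definition nbrs (x : G) : {set G} := out_nbrs x :|: in_nbrs x :|: und_nbrs x.

Definition degree (x : G) : nat := #|nbrs x|.
Definition out_degree (x : G) : nat := #|out_nbrs x|.
Definition in_degree (x : G) : nat := #|in_nbrs x|.

(* Every degree is less than #|G| and G is nonempty, so that the default value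
   #|G| is never returned. *)
Definition min_degree : nat := \big[minn/#|G|]_(x : G) degree x.

Definition is_mixed (c1 c2 : rat) : Prop :=
  forall u : G, (out_degree u)%:R <= c1 * (degree u)%:R
             /\ (in_degree u)%:R <= c2 * (degree u)%:R.

(* The directed graph D assigns exactly one direction to each undirected edge,
   keeps the arcs of G, and has no other arc. *)
Definition orientation (D : rel G) : Prop :=
  [/\ forall x y, darc x y -> D x y,
      forall x y, uedge x y -> D x y (+) D y x
    & forall x y, D x y -> darc x y || uedge x y].

End MixedGraph.

Section Digraph.
Variables (T : finType) (D : rel T).

Definition strongly_connected : Prop := forall x y : T, connect D x y.

(* The length of a shortest directed walk (hence path) from x to y. A shortest
   path has fewer than #|T| arcs, so that the default value #|T| is returned
   exactly when y is not reachable from x. *)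
Definition dist (x y : T) : nat :=
  \big[minn/#|T|]_(k < #|T| | [exists p : k.-tuple T,
                                 path D x p && (last x p == y)]) k.

Definition diameter : nat := \max_(p : T * T | p.1 != p.2) dist p.1 p.2.

End Digraph.

(* A minimum over a finite set of values, equal to +oo when G has no strongly
   connected orientation. *)
Definition oriented_diameter (R : realType) (G : mixed_graph) : \bar R :=
  ereal_inf [set d | exists D : rel G,
    [/\ orientation D, strongly_connected D & d = (diameter D)%:R%:E]]%classic.

Definition isomorphic (G H : mixed_graph) : Prop :=
  exists f : G -> H,
    [/\ bijective f,
        forall x y, uedge (f x) (f y) = uedge x y
      & forall x y, darc (f x) (f y) = darc x y].

(* Main.v *)
Require Import Defs.
From HB Require Import structures.
From mathcomp Require Import all_boot all_order all_algebra.
From mathcomp Require Import boolp classical_sets reals constructive_ereal ereal exp.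
From mathcomp Require Import zify ring lra.

(** Write M = 2r+1 and fix a set B0 of M vertices. The special vertices are a
    vertex y, joined to all of B0, and one vertex x_S for every subset S of B0,
    joined inside B0 exactly to the larger of S and its complement. All special
    vertices have the same out-neighbours P and the same in-neighbours Q, so
    that a directed path of length 2 between y and x_S must go through B0.
    Given an orientation, let S be the set of out-neighbours of y in B0: if x_S
    is joined to S, there is no such path from x_S to y; if it is joined to the
    complement of S, there is none from y to x_S.

    There are only 2^M special vertices, so the other vertices can be made a
    clique and be so numerous that their degrees are not critical. With
    c_i = e_i/d and t = 4^(r+1), take |P| = e1 t and |Q| = e2 t, and pad with
    private neighbours A of the x_S and B1 of y until y and the x_S have degree
    at least dt. Then the order is n = (2d - e1 - e2) t + 1 - r, and the degree
    bound amounts to ln n <= (r - 1) ln(27/4), which holds for large r because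
    n = O(4^r) and 4 < 27/4. The vertices of P have 2^M + 1 in-neighbours, hence
    the need for c_2 > 0 when c_1 > 0, and vice versa. *)

Set Implicit Arguments.
Unset Strict Implicit.
Unset Printing Implicit Defensive.

Import Order.TTheory GRing.Theory Num.Theory.

(** * Distances and orientations in general *)

Lemma leq_bigminn (I : Type) (s : seq I) (P : pred I) (F : I -> nat) (l n : nat) :
  l <= n -> (forall i, P i -> l <= F i) -> l <= \big[minn/n]_(i <- s | P i) F i.
Proof.
move=> ln lF; elim/big_rec: _ => // i x Pi lx; by rewrite leq_min lF.
Qed.

Lemma card_true (T : finType) : #|[pred x : T | true]| = #|T|.
Proof. exact: eq_card. Qed.

Lemma card_false (T : finType) : #|[pred x : T | false]| = 0.
Proof. exact: eq_card0. Qed.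

Lemma card_sum_pred (A B : finType) (f : pred (A + B)) :
  #|f| = #|[pred x | f (inl x)]| + #|[pred x | f (inr x)]|.
Proof. by rewrite -!sum1_card big_sumType. Qed.

(** Lengths 0, 1 and 2 are excluded one by one; the bound on [#|T|] covers the default value of
    [dist]. *)
Lemma dist_gt2 (T : finType) (D : rel T) (x y : T) :
  2 < #|T| -> x != y -> ~~ D x y -> (forall z, D x z -> ~~ D z y) ->
  2 < dist D x y.
Proof.
move=> T3 xy Dxy Dxzy; apply: leq_bigminn => // -[k kT] /= /existsP[p].
case/andP; case: k p {kT} => [|[|[|k]]] //.
- by move=> p _; rewrite [p]tuple0 /= (negPf xy).
- case/tupleP=> z p; rewrite [p]tuple0 /= andbT => Dxz /eqP zy.
  by rewrite zy (negPf Dxy) in Dxz.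
- case/tupleP=> z; case/tupleP=> z' p; rewrite [p]tuple0 /= andbT.
  by case/andP=> /Dxzy Dzy Dzz' /eqP zy; rewrite zy (negPf Dzy) in Dzz'.
Qed.

Lemma leq_diameter (T : finType) (D : rel T) (x y : T) :
  x != y -> dist D x y <= diameter D.
Proof.
by move=> xy; rewrite /diameter; apply: (leq_bigmax_cond (x, y)).
Qed.

Lemma orientation_arc (G : mixed_graph) (D : rel G) :
  orientation D -> forall x y, D x y -> ~~ darc y x.
Proof.
move=> [arcD edgeD Dedge] x y Dxy; apply/negP => yx.
have /orP[xy|xy] := Dedge _ _ Dxy; first by have := darc_asym xy; rewrite yx.
by have := darc_uedge yx; rewrite uedge_sym xy.
Qed.

Lemma orientation_asym (G : mixed_graph) (D : rel G) :
  orientation D -> forall x y, D x y -> ~~ D y x.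
Proof.
move=> oD x y Dxy; have [arcD edgeD Dedge] := oD; apply/negP => Dyx.
have /orP[xy|xy] := Dedge _ _ Dxy.
  by have := orientation_arc oD Dyx; rewrite xy.
by have := edgeD _ _ xy; rewrite Dxy Dyx.
Qed.

(** * The graph for arbitrary sizes of P, Q, A and B1 *)

Section Construction.
Variables r p q a b : nat.

(* The summands are P, Q, A, B0 and B1. *)
Definition core : Type := 'I_p + 'I_q + ('I_a + ('I_(r.*2.+1) + 'I_b)).

(* [None] is y and [Some S] is x_S. *)
Definition special : Type := option {set 'I_(r.*2.+1)}.

HB.instance Definition _ := Finite.on core.
HB.instance Definition _ := Finite.on special.

Definition majority (S : {set 'I_(r.*2.+1)}) : {set 'I_(r.*2.+1)} :=
  if r < #|S| then S else ~: S.

Lemma card_majority S : r < #|majority S|.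
Proof.
rewrite /majority; case: (ltnP r #|S|) => // rS.
have := cardsC S; rewrite card_ord; lia.
Qed.

Definition sink (c : core) : bool := if c is inl (inl _) then true else false.
Definition source (c : core) : bool := if c is inl (inr _) then true else false.

Definition link (x : special) (c : core) : bool :=
  match x, c with
  | Some J, inr (inl _) => true
  | Some J, inr (inr (inl i)) => i \in majority J
  | None, inr (inr _) => true
  | _, _ => false
  end.

Definition cvertex : Type := special + core.
HB.instance Definition _ := Finite.on cvertex.

(** The clique on the x_S adds 2^M - 1 to each of their degrees; as y has no neighbour in it, no
    path of length 2 from or to y passes through it. *)
Definition cuedge (u v : cvertex) : bool :=
  match u, v with
  | inl (Some J), inl (Some J') => J != J'
  | inl x, inr c | inr c, inl x => link x c
  | inr c, inr c' => c != c'
  | _, _ => false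
  end.

Definition cdarc (u v : cvertex) : bool :=
  match u, v with
  | inl _, inr c => sink c
  | inr c, inl _ => source c
  | _, _ => false
  end.

Lemma card_core : #|{: core}| = p + q + (a + (r.*2.+1 + b)).
Proof. by rewrite !card_sum !card_ord. Qed.

Lemma card_special : #|{: special}| = (2 ^ r.*2.+1).+1.
Proof.
by rewrite card_option -cardsT -powersetT card_powerset cardsT card_ord.
Qed.

Lemma card_cvertex :
  #|{: cvertex}| = (2 ^ r.*2.+1).+1 + (p + q + (a + (r.*2.+1 + b))).
Proof. by rewrite card_sum card_core card_special. Qed.

Lemma cvertex_gt0 : 0 < #|{: cvertex}|. Proof. by rewrite card_cvertex. Qed.

Lemma cuedge_sym : symmetric cuedge.
Proof. by case=> [[S|]|c] [[S'|]|c'] //=; rewrite eq_sym. Qed.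

Lemma cuedge_irr : irreflexive cuedge.
Proof. by case=> [[S|]|c] //=; rewrite eqxx. Qed.

Lemma cdarc_irr : irreflexive cdarc.
Proof. by case. Qed.

Lemma cdarc_asym u v : cdarc u v -> ~~ cdarc v u.
Proof. by case: u v => [x|[[?|?]|?]] [y|[[?|?]|?]]. Qed.

Lemma cdarc_cuedge u v : cdarc u v -> ~~ cuedge u v.
Proof. by case: u v => [[S|]|[[?|?]|?]] [[S'|]|[[?|?]|?]]. Qed.

Definition cgraph : mixed_graph :=
  MixedGraph cvertex_gt0 cuedge_sym cuedge_irr cdarc_irr cdarc_asym cdarc_cuedge.

Lemma card_out_nbrs (u : cgraph) : out_degree u =
  #|[pred x | cdarc u (inl x)]| + #|[pred c | cdarc u (inr c)]|.
Proof. by rewrite /out_degree /out_nbrs cardsE card_sum_pred. Qed.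

Lemma card_in_nbrs (u : cgraph) : in_degree u =
  #|[pred x | cdarc (inl x) u]| + #|[pred c | cdarc (inr c) u]|.
Proof. by rewrite /in_degree /in_nbrs cardsE card_sum_pred. Qed.

Definition cadj (u v : cvertex) := [|| cdarc u v, cdarc v u | cuedge u v].

Lemma card_nbrs (u : cgraph) : degree u =
  #|[pred x | cadj u (inl x)]| + #|[pred c | cadj u (inr c)]|.
Proof.
rewrite /degree -card_sum_pred; apply: eq_card => v.
by rewrite /nbrs !inE -orbA.
Qed.

Lemma card_core_pred (f : pred core) :
  #|f| = #|[pred i | f (inl (inl i))]| + #|[pred i | f (inl (inr i))]|
       + (#|[pred i | f (inr (inl i))]|
       + (#|[pred i | f (inr (inr (inl i)))]| + #|[pred i | f (inr (inr (inr i)))]|)).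
Proof. by rewrite !card_sum_pred. Qed.

(** The 2^M - 1 other vertices of the clique and the at least r + 1 neighbours in B0 add up to 2^M +
    r. *)
Lemma degree_set (S : {set 'I_(r.*2.+1)}) :
  2 ^ r.*2.+1 + p + q + a + r <= degree (inl (Some S) : cgraph).
Proof.
rewrite card_nbrs card_core_pred /cadj /= !card_true card_false !card_ord.
have -> : #|[pred i | i \in majority S]| = #|majority S| by exact: eq_card.
have := card_majority S.
have := cardC (pred2 (None : special) (Some S)).
rewrite card2 card_special /=; set k := #|[predC _]|.
have -> : k = #|[pred x | cadj (inl (Some S)) (inl x)]|.
  apply: eq_card => -[S'|]; rewrite !inE //= /cadj /=.
  by rewrite eq_sym.
rewrite /cadj /=; lia.
Qed.

Lemma degree_none : p + q + (r.*2.+1 + b) <= degree (inl None : cgraph).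
Proof.
by rewrite card_nbrs card_core_pred /cadj /= !card_true !card_false !card_ord; lia.
Qed.

(** The core is a clique, and a special neighbour of [c] makes up for [c] itself: y, or some x_S
    when [c] lies in A. *)
Lemma degree_core (c : core) :
  p + q + (a + (r.*2.+1 + b)) <= degree (inr c : cgraph).
Proof.
rewrite card_nbrs -card_core.
have -> : #|{: core}| = 1 + #|predC1 c|
  by rewrite (cardC1 c) add1n prednK //; apply/card_gt0P; exists c.
apply: leq_add.
  apply/card_gt0P; case: c => [[?|?]|[?|?]]; rewrite /cadj /=;
    by [exists None | exists (Some finset.set0)].
apply/subset_leq_card/fintype.subsetP => c'; rewrite !inE /cadj /= => cc'.
by rewrite eq_sym.
Qed.

Lemma leq_out_degree (u : cgraph) :
  (0 < q -> 2 ^ r.*2.+1 < p) -> out_degree u <= p.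
Proof.
move=> qp; rewrite card_out_nbrs card_core_pred.
case: u => [x|[[?|i]|[?|[?|?]]]] /=;
  rewrite ?card_true ?card_false ?card_special ?card_ord ?addn0 //.
by apply: qp; case: i => i; apply: leq_ltn_trans.
Qed.

Lemma leq_in_degree (u : cgraph) :
  (0 < p -> 2 ^ r.*2.+1 < q) -> in_degree u <= q.
Proof.
move=> pq; rewrite card_in_nbrs card_core_pred.
case: u => [x|[[i|?]|[?|[?|?]]]] /=;
  rewrite ?card_true ?card_false ?card_special ?card_ord ?addn0 //.
by apply: pq; case: i => i; apply: leq_ltn_trans.
Qed.

Lemma diameter_cgraph_gt2 (D : rel cgraph) : orientation D -> 2 < diameter D.
Proof.
move=> oD; have [arcD edgeD Dedge] := oD.
pose y : cgraph := inl None.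
pose O := [set i | D y (inr (inr (inr (inl i))))].
pose x : cgraph := inl (Some O).
have V3 : 2 < #|cgraph|.
  by rewrite card_cvertex expnS; have := expn_gt0 2 r.*2; lia.
have [OO|OO] : majority O = O \/ majority O = ~: O.
  by rewrite /majority; case: ifP; [left | right].
- apply: leq_trans (leq_diameter D (isT : x != y)).
  apply: dist_gt2 => //; first by apply/negP => /Dedge.
  case=> [[S|]|[[i|i]|[i|[i|i]]]] Dxz; apply/negP => Dzy.
  (* Only z in B0 survives: the arcs at P and Q point the wrong way, and any other z misses x or
     y. *)
  all: try by have := Dedge _ _ Dxz.
  all: try by have := Dedge _ _ Dzy.
  have := Dedge _ _ Dxz; rewrite /= OO inE => Dyz.
  by have := orientation_asym oD Dyz; rewrite Dzy.
- apply: leq_trans (leq_diameter D (isT : y != x)).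
  apply: dist_gt2 => //; first by apply/negP => /Dedge.
  case=> [[S|]|[[i|i]|[i|[i|i]]]] Dyz; apply/negP => Dzx.
  all: try by have := Dedge _ _ Dyz.
  all: try by have := Dedge _ _ Dzx.
  by have := Dedge _ _ Dzx; rewrite /= OO !inE Dyz.
Qed.

End Construction.

(** * Choice of the sizes and estimates in r *)

Lemma isomorphic_card (G H : mixed_graph) : isomorphic G H -> #|G| = #|H|.
Proof. by case=> f [/bij_eq_card]. Qed.

Lemma pow16_27 r : r * 16 ^ r <= 2 * 27 ^ r.
Proof.
(* With r + 2 the induction step is 16(r + 3) <= 27(r + 2), true for all r; with r itself it fails
   at r = 1. *)
suff : r.+2 * 16 ^ r <= 2 * 27 ^ r.
  by apply: leq_trans; rewrite leq_mul2r; apply/orP; right; lia.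
elim: r => // r IH; rewrite !expnS.
nia.
Qed.

Section Family.
Variables e1 e2 d : nat.

Local Notation w := (d - (e1 + e2)).
Local Notation t r := (4 ^ r.+1).

(** For e1 + e2 < d nothing is truncated, since 2^M + r <= t and M <= t; the bounds of [degree_set]
    and [degree_none] then equal dt. *)
Definition pgraph r := cgraph r (e1 * t r) (e2 * t r)
  (w * t r - (2 ^ r.*2.+1 + r)) (w * t r - r.*2.+1).

Lemma exp2_odd r : 2 ^ r.*2.+1 = 2 * 4 ^ r.
Proof. by rewrite expnS -mul2n expnM. Qed.

Lemma exp4_gt r : r < 4 ^ r. Proof. exact: ltn_expl. Qed.

(** The padding cancels 2^M and M. The r vertices saved, from the overlap of the neighbourhoods of y
    and x_S in B0, yield the logarithmic term. *)
Lemma card_pgraph (e12_lt : e1 + e2 < d) r :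
  #|pgraph r| + r = (2 * d - (e1 + e2)) * t r + 1.
Proof.
rewrite card_cvertex exp2_odd expnS; have := exp4_gt r.
move: (4 ^ r) => X rX; nia.
Qed.

Lemma ltn_card_pgraph (e12_lt : e1 + e2 < d) r : #|pgraph r| < #|pgraph r.+1|.
Proof.
have := card_pgraph e12_lt r; have := card_pgraph e12_lt r.+1; rewrite (expnS 4 r.+1).
have : 0 < t r by rewrite expn_gt0.
have : 0 < 2 * d - (e1 + e2) by lia.
move: (t r) (2 * d - _) => X Y; nia.
Qed.

Lemma degree_pgraph (e12_lt : e1 + e2 < d) r (u : pgraph r) : d * t r <= degree u.
Proof.
have -> : d * t r = e1 * t r + e2 * t r + w * t r.
  by rewrite -!mulnDl subnKC // ltnW.
have : 2 ^ r.*2.+1 + r <= w * t r.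
  by rewrite exp2_odd expnS; have := exp4_gt r; nia.
have : r.*2.+1 <= w * t r.
  by rewrite expnS; have := exp4_gt r; nia.
case: u => [[S|]|c] b_ge a_ge.
- by apply: leq_trans (degree_set _ _ _ _ S); lia.
- by apply: leq_trans (degree_none _ _ _ _ _); lia.
- by apply: leq_trans (degree_core c); lia.
Qed.

Lemma min_degree_pgraph (e12_lt : e1 + e2 < d) r : d * t r <= min_degree (pgraph r).
Proof.
apply: leq_bigminn => [|u _]; last exact: degree_pgraph.
apply: leq_trans (degree_pgraph e12_lt (inl None : pgraph r)) _; exact: max_card.
Qed.

(** Since t = 2 * 2^M, P and Q, when nonempty, are at least as large as the set of special
    vertices. *)
Lemma exp2_odd_lt e r : 0 < e -> 2 ^ r.*2.+1 < e * t r.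
Proof. by rewrite exp2_odd expnS; have := expn_gt0 4 r; nia. Qed.

Lemma leq_card_pgraph (e12_lt : e1 + e2 < d) r :
  108 * d <= r -> #|pgraph r| * 4 ^ r.-1 <= 27 ^ r.-1.
Proof.
(* The left side is at most 2d * 16^r, and [pow16_27] gives 27^(r-1) >= r * 16^r / 54; hence 108 = 2
   * 54. *)
move=> dr; have := card_pgraph e12_lt r; have := pow16_27 r.
case: r dr => [|r] dr; first by lia.
have : 4 ^ r * 4 ^ r = 16 ^ r by rewrite -expnMn.
rewrite !expnS /=; move: (16 ^ r) (27 ^ r) (4 ^ r) => X Y Z.
move: (#|_|) => n; nia.
Qed.

Lemma out_degree_pgraph (e12_lt : e1 + e2 < d)
    (e12_eq0 : (0 < e1) = (0 < e2)) r (u : pgraph r) :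
  out_degree u * d <= e1 * degree u.
Proof.
apply: (@leq_trans (e1 * t r * d)).
  rewrite leq_mul2r leq_out_degree ?orbT // muln_gt0 => /andP[e2_gt0 _].
  by rewrite exp2_odd_lt ?e12_eq0.
by rewrite -mulnA leq_mul2l (mulnC _ d) (degree_pgraph e12_lt) orbT.
Qed.

Lemma in_degree_pgraph (e12_lt : e1 + e2 < d)
    (e12_eq0 : (0 < e1) = (0 < e2)) r (u : pgraph r) :
  in_degree u * d <= e2 * degree u.
Proof.
apply: (@leq_trans (e2 * t r * d)).
  rewrite leq_mul2r leq_in_degree ?orbT // muln_gt0 => /andP[e1_gt0 _].
  by rewrite exp2_odd_lt -?e12_eq0.
by rewrite -mulnA leq_mul2l (mulnC _ d) (degree_pgraph e12_lt) orbT.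
Qed.

End Family.

(** * Passage to rational and real numbers *)

Local Open Scope ring_scope.

Lemma rat_fractionE (c : rat) :
  0 <= c -> exists2 e : nat * nat, (0 < e.2)%N & c = e.1%:R / e.2%:R.
Proof.
move=> c_ge0; exists (`|numq c|%N, `|denq c|%N); first by rewrite absz_gt0 denq_neq0.
by rewrite -[LHS]divq_num_den /= !natr_absz !ger0_norm ?numq_ge0 ?denq_ge0.
Qed.

Lemma common_denominator (c1 c2 : rat) : 0 <= c1 -> 0 <= c2 -> exists e1 e2 d : nat,
  [/\ (0 < d)%N, c1 = e1%:R / d%:R & c2 = e2%:R / d%:R].
Proof.
move=> /rat_fractionE[[e1 d1] /= d1_gt0 ->] /rat_fractionE[[e2 d2] /= d2_gt0 ->].
exists (e1 * d2)%N, (e2 * d1)%N, (d1 * d2)%N; split.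
- by rewrite muln_gt0 d1_gt0.
- by rewrite !natrM; field; rewrite !pnatr_eq0 -!lt0n d1_gt0 d2_gt0.
- by rewrite !natrM; field; rewrite !pnatr_eq0 -!lt0n d1_gt0 d2_gt0.
Qed.

Lemma ln_card_pgraph (R : realType) (e1 e2 d r : nat) : (e1 + e2 < d)%N ->
  (108 * d <= r)%N ->
  ln (#|pgraph e1 e2 d r|%:R : R) <= r.-1%:R * ln (27 / 4).
Proof.
move=> e12_lt dr.
have q_gt0 : (0 : R) < 27 / 4 by rewrite divr_gt0 // ltr0n.
have n_gt0 : (0 : R) < #|pgraph e1 e2 d r|%:R by rewrite ltr0n vertex_gt0.
rewrite mulr_natl -lnXn // ler_ln ?posrE ?exprn_gt0 //.
have p4_gt0 : (0 : R) < 4 ^+ r.-1 by rewrite exprn_gt0 // ltr0n.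
rewrite expr_div_n ler_pdivlMr // -!natrX -natrM ler_nat.
exact: leq_card_pgraph.
Qed.

Theorem theorem2p4 (R : realType) (c1 c2 : rat)
    (hc1 : 0 <= c1 <= 1) (hc2 : 0 <= c2 <= 1)
    (hlt : c1 + c2 < 1) (hzero : c1 = 0 <-> c2 = 0) :
  exists G : nat -> mixed_graph,
    (forall m m' : nat, isomorphic (G m) (G m') -> m = m') /\
    forall m : nat,
      let n : R := #|G m|%:R in
      let s : R := 2 - ratr c1 - ratr c2 in
      [/\ is_mixed (G m) c1 c2,
          1 / s * n + 2 / s * (ln n / (2 * ln (27 / 4))) <= (min_degree (G m))%:R
        & (3%:R%:E <= oriented_diameter R (G m))%E].
Proof.
have [/andP[c1_ge0 _] /andP[c2_ge0 _]] := (hc1, hc2).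
have [e1 [e2 [d [d_gt0 c1E c2E]]]] := common_denominator c1_ge0 c2_ge0.
have dQ_gt0 : (0 : rat) < d%:R by rewrite ltr0n.
have dR_gt0 : (0 : R) < d%:R by rewrite ltr0n.
have e12_lt : (e1 + e2 < d)%N.
  move: hlt; rewrite c1E c2E -mulrDl ltr_pdivrMr // mul1r -natrD ltr_nat //.
have e12_eq0 : (0 < e1)%N = (0 < e2)%N.
  have cE e : (e%:R / d%:R == 0 :> rat) = (e == 0)%N.
    by rewrite mulf_eq0 invr_eq0 !pnatr_eq0 (gtn_eqF d_gt0) orbF.
  rewrite !lt0n -!cE -c1E -c2E; congr (~~ _).
  by apply/eqP/eqP => /hzero.
pose rk (m : nat) := (108 * d + m)%N.
exists (fun m => pgraph e1 e2 d (rk m)); split.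
  (* The orders strictly increase, so distinct members are not isomorphic. *)
  have incr := @homo_ltn _ (fun r => #|pgraph e1 e2 d r|)
    (fun k l => k < l)%N ltn_trans (ltn_card_pgraph e12_lt).
  move=> m m' /isomorphic_card /= eq_card.
  have : rk m = rk m'.
    by case: (ltngtP (rk m) (rk m')) => // /incr /=; rewrite eq_card ltnn.
  by move/addnI.
move=> m n s; set r := rk m in n *; set G := pgraph e1 e2 d r in n *.
have dr : (108 * d <= r)%N by exact: leq_addr.
clearbody r.
split.
- move=> u; rewrite c1E c2E -!(mulrAC _ _ d%:R^-1) !ler_pdivlMr // -!natrM !ler_nat.
  by rewrite out_degree_pgraph // in_degree_pgraph.
- have sE : s = (2 * d%:R - (e1%:R + e2%:R)) / d%:R.
    rewrite /s c1E c2E !fmorph_div /= !ratr_nat; field; exact: lt0r_neq0.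
  have s_gt0 : 0 < s.
    rewrite sE divr_gt0 // subr_gt0 -natrD -natrM ltr_nat; lia.
  have l_gt0 : 0 < ln (27 / 4) :> R by rewrite ln_gt0 // ltr_pdivlMr //; lra.
  apply: (@le_trans _ _ (d * 4 ^ r.+1)%:R); last by rewrite ler_nat min_degree_pgraph.
  have -> : 1 / s * n + 2 / s * (ln n / (2 * ln (27 / 4)))
      = (n + ln n / ln (27 / 4)) / s.
    by field; rewrite !lt0r_neq0.
  rewrite ler_pdivrMr //.
  (* As ds = 2d - e1 - e2, this is [card_pgraph]; what remains is ln n / ln(27/4) <= r - 1. *)
  have -> : (d * 4 ^ r.+1)%:R * s = n + r.-1%:R.
    have r_gt0 : (0 < r)%N by lia.
    have := congr1 (GRing.natmul (1 : R)) (card_pgraph e12_lt r).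
    have rE : r%:R = r.-1%:R + 1 :> R by rewrite -{1}(prednK r_gt0) natr1.
    rewrite natrD natrD natrM natrB; last lia.
    rewrite -/G -/n rE natrD natrM => nE.
    have -> : n = (2 * d%:R - (e1%:R + e2%:R)) * (4 ^ r.+1)%:R - r.-1%:R by lra.
    rewrite sE; field; exact: lt0r_neq0.
  by rewrite lerD2l ler_pdivrMr // ln_card_pgraph.
- apply: le_ereal_inf_tmp => _ [D [oD _ ->]].
  by rewrite lee_fin ler_nat diameter_cgraph_gt2.
Qed.
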